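(* Let $A\in\operatorname{EigSpSm}(2n)$. The symplectic eigenvalues of $A$ are given by $\frac12\xi(A)$ zeros, the negative eigenvalues of the Hermitian matrix $iA_-^{1/2}JA_-^{1/2}$, and the positive eigenvalues of the Hermitian matrix $iA_+^{1/2}JA_+^{1/2}$ (all counted with multiplicity).
   Context: $J=J_{2n}=\begin{pmatrix}0&I_n\\-I_n&0\end{pmatrix}$, $i=\sqrt{-1}$, and $\langle x,y\rangle=x^{\top}y$. $\operatorname{Sp}(2n)$ is the set of $2n\times 2n$ real matrices $M$ with $M^{\top}JM=J$. For a subset $\mathscr{X}\subseteq\mathbb{R}^{2n}$, $\mathscr{X}^{\perp_{\operatorname{s}}}=\{u\in\mathbb{R}^{2n}:\langle u,Jv\rangle=0\ \forall v\in\mathscr{X}\}$. A linear subspace $\mathscr{W}$ is a symplectic subspace if $\mathscr{W}\cap\mathscr{W}^{\perp_{\operatorname{s}}}=\{0\}$ (the zero subspace is allowed). Symplectic subspaces $\mathscr{W},\mathscr{Z}$ are symplectically orthogonal to each other if $\mathscr{Z}\subseteq\mathscr{W}^{\perp_{\operatorname{s}}}$. $\xi(A)$ is the number of zero eigenvalues of $A$ (with multiplicity). For a real symmetric matrix $A$, $|A|=(A^2)^{1/2}$, $A_-=\frac12(|A|-A)$ and $A_+=\frac12(|A|+A)$, which are positive semidefinite with $A=A_+-A_-$; $B^{1/2}$ denotes the positive semidefinite square root of a positive semidefinite $B$. For a $2n\times 2n$ real symmetric matrix $A$, let $\mathscr{E}_-,\mathscr{E}_0,\mathscr{E}_+$ be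 the subspaces of $\mathbb{R}^{2n}$ spanned by the eigenvectors of $A$ corresponding to its negative, zero, and positive eigenvalues, respectively. $\operatorname{EigSpSm}(2n)$ is the set of $2n\times 2n$ real symmetric matrices $A$ for which $\mathscr{E}_-,\mathscr{E}_0,\mathscr{E}_+$ are pairwise symplectically orthogonal symplectic subspaces, each invariant under $JA$. For every such $A$ there exist $M\in\operatorname{Sp}(2n)$ and an $n\times n$ real diagonal matrix $D$, unique up to ordering of its diagonal entries, with $M^{\top}AM=D\oplus D$; the $n$ diagonal entries of $D$ are called the symplectic eigenvalues of $A$. *)

(* Defs.v *)
From mathcomp Require Import all_boot all_order all_algebra.
From mathcomp Require Import boolp classical_sets reals.
From mathcomp Require Import complex.

Set Implicit Arguments.
Unset Strict Implicit.
Unset Printing Implicit Defensive.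

Import Order.TTheory GRing.Theory Num.Theory.
Local Open Scope classical_set_scope.
Local Open Scope ring_scope.
Local Open Scope complex_scope.

(* Real 2n x 2n matrices have type 'M[R]_(n + n); vectors are columns. *)

Section Symplectic.
Variables (R : realType) (n : nat).
Implicit Types (M A : 'M[R]_(n + n)) (X W Z : set 'cV[R]_(n + n)).

Definition sympJ : 'M[R]_(n + n) := block_mx 0 1%:M (- 1%:M) 0.

Definition symplectic M := M^T *m sympJ *m M = sympJ.

Definition dotv (x y : 'cV[R]_(n + n)) : R := (x^T *m y) 0 0.

Definition sperp X : set 'cV[R]_(n + n) :=
  [set u | forall v, X v -> dotv u (sympJ *m v) = 0].

Definition symplectic_subspace W :=
  GRing.submod_closed [in W] /\ W `&` sperp W = [set 0].

Definition sympl_orthogonal W Z := Z `<=` sperp W.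

Definition invariant_under M W := [set M *m v | v in W] `<=` W.

Definition lin_span X : set 'cV[R]_(n + n) :=
  [set v | exists (k : nat) (c : 'I_k -> R) (x : 'I_k -> 'cV[R]_(n + n)),
     (forall i, X (x i)) /\ v = \sum_i c i *: x i].

(* Span of the eigenvectors of A whose eigenvalue satisfies P. *)
Definition eigspan A (P : R -> Prop) : set 'cV[R]_(n + n) :=
  lin_span [set v | v != 0 /\ exists a : R, P a /\ A *m v = a *: v].

Definition Eneg A := eigspan A (fun a => a < 0).
Definition Ezero A := eigspan A (fun a => a = 0).
Definition Epos A := eigspan A (fun a => 0 < a).

Definition EigSpSm A :=
  [/\ A^T = A,
      [/\ symplectic_subspace (Eneg A), symplectic_subspace (Ezero A)
        & symplectic_subspace (Epos A)],
      [/\ sympl_orthogonal (Eneg A) (Ezero A),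
          sympl_orthogonal (Eneg A) (Epos A)
        & sympl_orthogonal (Ezero A) (Epos A)]
    & [/\ invariant_under (sympJ *m A) (Eneg A),
          invariant_under (sympJ *m A) (Ezero A)
        & invariant_under (sympJ *m A) (Epos A)]].

(* The entries of d, with multiplicity, are the symplectic eigenvalues of A. *)
Definition is_sympl_eigenvalues A (d : 'rV[R]_n) :=
  exists M, symplectic M /\
    M^T *m A *m M = block_mx (diag_mx d) 0 0 (diag_mx d).

End Symplectic.

Arguments sympJ {R n}.

Section SquareRoot.
Variables (R : realType) (m : nat).
Implicit Types A B : 'M[R]_m.

Definition psdmx B := B^T = B /\ forall v : 'cV[R]_m, 0 <= (v^T *m B *m v) 0 0.

(* The positive semidefinite square root, which exists and is unique when B is
   positive semidefinite; 0 is a dummy value for all other B. *)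
Definition sqrtmx B : 'M[R]_m := xget 0 [set C | psdmx C /\ C *m C = B].

Definition absmx A := sqrtmx (A *m A).
Definition negpart A := 2^-1 *: (absmx A - A).
Definition pospart A := 2^-1 *: (absmx A + A).

Definition xi A : nat := mup 0 (char_poly A).

End SquareRoot.

(* Listed with algebraic multiplicity, in an unspecified order. *)
Definition eigenvalues (C : closedFieldType) m (H : 'M[C]_m) : seq C :=
  sval (closed_field_poly_normal (char_poly H)).

Definition iBJB (R : realType) n (B : 'M[R]_(n + n)) : 'M[R[i]]_(n + n) :=
  'i%C *: map_mx (real_complex R) (sqrtmx B *m sympJ *m sqrtmx B).

(* Main.v *)
Require Import Defs.
From mathcomp Require Import all_boot all_order all_algebra.
From mathcomp Require Import classical_sets reals complex.
From mathcomp Require Import ring.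

(** Write A_+ = B^2 and A_- = C^2 with B, C positive semidefinite, so that
    A = B^2 - C^2. The columns of B lie in the positive eigenspace of A and
    those of C in the negative one; as these are symplectically orthogonal,
    B J C = 0 ([sqrt_parts]).

    Fix l > 0. The claim is that the eigenspace of H = iBJB for l has the
    dimension #{j | d_j = l} ([card_spectral_diag_eq]). Through M the matrix
    iJA is similar to iJ(D (+) D), whose eigenspace for l is spanned by the
    vectors (i e_j, e_j) with d_j = l and (-i e_j, e_j) with d_j = -l. The
    Hermitian form w^* A w tells these two kinds apart: it is positive on the
    span of the former and negative on the span of the latter, while in general
    w^* A w = |Bw|^2 - |Cw|^2. Two linear maps compare the two sides.
    - An eigenvector v of H for l is sent to w = JBv, which is an eigenvector
      of iJA for l because BJC = 0. Here Cw = 0 and |Bw| = l|v|, so the form is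
      positive at w, and w must have a nonzero component on some (i e_j, e_j)
      with d_j = l ([eigvec_lower]).
    - A vector w of the span of the M (i e_j, e_j) with d_j = l is sent to Bw,
      an eigenvector of H for l. If Bw = 0 the form is nonpositive at w, so
      w = 0 ([eigvec_upper]).
    Both maps being injective, the dimensions agree.

    The negative d_j are obtained from the same result for -A, whose symplectic
    eigenvalues are the -d_j and for which the roles of B and C are exchanged;
    the spectrum of iCJC is symmetric about 0 since iCJC is Hermitian and
    skew-symmetric ([mup_char_poly_skew]). Finally A is congruent to D (+) D,
    so they have kernels of the same dimension, which for the symmetric matrix A
    is xi(A) ([xi_sympl_eigenvalues]). *)

Set Implicit Arguments.
Unset Strict Implicit.
Unset Printing Implicit Defensive.

Import Order.TTheory GRing.Theory Num.Theory.
Local Open Scope ring_scope.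
Local Open Scope sesquilinear_scope.

(** * Diagonalization of real symmetric matrices *)

Lemma char_poly_diagonalized (K : fieldType) m (Q : 'M[K]_m) (s : 'rV[K]_m) :
  Q \in unitmx ->
  char_poly (invmx Q *m diag_mx s *m Q) = \prod_i ('X - (s 0 i)%:P).
Proof.
move=> Qu; set D := diag_mx s.
have QXu : map_mx polyC Q \in unitmx by rewrite map_unitmx.
have -> : char_poly (invmx Q *m D *m Q) = char_poly D.
  rewrite /char_poly.
  have -> : char_poly_mx (invmx Q *m D *m Q) =
      invmx (map_mx polyC Q) *m char_poly_mx D *m map_mx polyC Q.
    rewrite /char_poly_mx mulmxBr mulmxBl !map_mxM map_invmx.
    by rewrite scalar_mxC mulmxKV.
  by rewrite !det_mulmx det_inv mulrAC mulVr ?mul1r // -unitmxE.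
rewrite char_poly_trig ?diag_mx_is_trig //.
by apply: eq_bigr => i _; rewrite !mxE eqxx.
Qed.

(** Over the complex numbers the spectral theorem applies, with real
    eigenvalues; and two real matrices that are similar over the complex numbers
    are similar over the reals. The real conjugating matrix obtained this way
    need not be orthogonal. *)
Lemma symmetric_diagonalizable (R : realType) m (A : 'M[R]_m) : A^T = A ->
  exists (Q : 'M[R]_m) (s : 'rV[R]_m),
    Q \in unitmx /\ A = invmx Q *m diag_mx s *m Q.
Proof.
move=> Asym; pose rc := real_complex R; pose re := complex.Re (R:=R).
have reE (X : R[i]) : X \is Num.real -> rc (re X) = X.
  exact: RRe_real.
have rcReal p q (X : 'M[R]_(p, q)) : map_mx rc X \is a mxOver Num.real.
  by apply/mxOverP => i j; rewrite mxE; apply/complex_realP; eexists.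
have Aherm : map_mx rc A \is hermsymmx.
  apply: realsym_hermsym => //; apply/is_hermitianmxP.
  by rewrite expr0 scale1r map_mx_id // map_trmx Asym.
have Asp := orthomx_spectralP (hermitian_normalmx Aherm).
have Sreal := hermitian_spectral_diag_real Aherm.
move: (spectral_diag _) (spectralmx _) (spectral_unit (map_mx rc A)) Asp Sreal.
move=> s P Pu Asp Sreal.
have [||Q /andP[Qreal Qu]] := @real_similar _ _ (map_mx rc A) (diag_mx s) _
    (rcReal _ _ _).
- exists P => //; apply/similarP => //.
  by rewrite Asp !mulmxA mulmxV // mul1mx.
- apply/mxOverP => i j; rewrite mxE; case: (i == j); rewrite ?mulr1n ?mulr0n //.
  exact: (mxOverP Sreal).
move/(similarP Qu) => QA.
have QE : Q = map_mx rc (map_mx re Q).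
  by apply/matrixP => i j; rewrite !mxE reE ?(mxOverP Qreal).
have sE : s = map_mx rc (map_mx re s).
  by apply/matrixP => i j; rewrite !mxE reE ?(mxOverP Sreal).
have Qu' : map_mx re Q \in unitmx by rewrite -(map_unitmx rc) -QE.
exists (map_mx re Q), (map_mx re s); split=> //.
rewrite -mulmxA -[LHS](mulKmx Qu'); congr (_ *m _).
apply: (@map_mx_inj _ _ rc); rewrite !map_mxM map_diag_mx -QE -sE.
exact: QA.
Qed.

(** * Functional calculus and positive semidefinite square roots *)

Section FunctionalCalculus.
Variables (R : realType) (m : nat) (Q : 'M[R]_m) (s : 'rV[R]_m).
Hypothesis Qu : Q \in unitmx.
Implicit Types f g : R -> R.

(** This is g(A) for the matrix A = Q^-1 diag(s) Q, which is itself the value at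
    the identity function. *)
Definition spectral_fun g := invmx Q *m diag_mx (map_mx g s) *m Q.

Lemma spectral_funM f g :
  spectral_fun f *m spectral_fun g = spectral_fun (fun a => f a * g a).
Proof.
rewrite /spectral_fun !mulmxA mulmxK // -(mulmxA (invmx Q)) mulmx_diag.
by congr (_ *m diag_mx _ *m _); apply/rowP => j; rewrite !mxE.
Qed.

Lemma spectral_fun_lin c f g :
  c *: (spectral_fun f + spectral_fun g) =
  spectral_fun (fun a => c * (f a + g a)).
Proof.
rewrite /spectral_fun -mulmxDl -mulmxDr scalemxAl scalemxAr.
congr (_ *m _ *m _); apply/matrixP => i j.
by rewrite !mxE; case: (i == j); rewrite ?mulr1n // !mulr0n addr0 mulr0.
Qed.

Lemma spectral_funN f : - spectral_fun f = spectral_fun (fun a => - f a).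
Proof.
rewrite /spectral_fun -mulNmx -mulmxN; congr (_ *m _ *m _).
by apply/matrixP => i j; rewrite !mxE; case: (i == j); rewrite ?oppr0.
Qed.

Lemma eq_spectral_fun f g : f =1 g -> spectral_fun f = spectral_fun g.
Proof. by move=> fg; rewrite /spectral_fun (eq_map_mx _ fg). Qed.

Hypothesis sym_id : (spectral_fun id)^T = spectral_fun id.

(** That Q^-1 diag(s) Q is symmetric means that the Gram matrix Q Q^T commutes
    with diag(s); it then preserves the eigenspaces of diag(s), hence commutes
    with diag(g(s)) too. This replaces the orthogonality of Q. *)
Lemma trmx_spectral_fun g : (spectral_fun g)^T = spectral_fun g.
Proof.
have QTu : Q^T \in unitmx by rewrite unitmx_tr.
pose G := Q *m Q^T.
have commG : G *m diag_mx s = diag_mx s *m G.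
  move: sym_id; rewrite /spectral_fun map_mx_id // !trmx_mul tr_diag_mx.
  rewrite trmx_inv; move=> /(congr1 (fun X => Q *m X *m Q^T)).
  by rewrite !mulmxA mulmxKV // mulmxV // mul1mx -!mulmxA.
have commGg : G *m diag_mx (map_mx g s) = diag_mx (map_mx g s) *m G.
  apply/matrixP => i j; move/matrixP/(_ i j): commG.
  rewrite !mul_mx_diag !mul_diag_mx !mxE [RHS]mulrC [in X in _ -> X]mulrC.
  set x := \sum_k _; have [-> _|x0] := eqVneq x 0.
    by rewrite !(mul0r, mulr0).
  by move/(mulfI x0) => ->; rewrite mulrC.
rewrite /spectral_fun !trmx_mul tr_diag_mx trmx_inv.
rewrite -[RHS](mulmxK QTu) mulmxA; congr (_ *m _).
by rewrite -!mulmxA -/G -commGg !mulmxA mulVmx // mul1mx.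
Qed.

Lemma spectral_fun_psd g : (forall a, 0 <= g a) -> psdmx (spectral_fun g).
Proof.
move=> g0; split=> [|v]; first exact: trmx_spectral_fun.
pose S := spectral_fun (fun a => Num.sqrt (g a)).
have -> : spectral_fun g = S^T *m S.
  rewrite trmx_spectral_fun spectral_funM; apply: eq_spectral_fun => a.
  by rewrite /= -expr2 sqr_sqrtr.
rewrite -mulmxA -mulmxA mulmxA -trmx_mul mxE.
by apply: sumr_ge0 => i _; rewrite mxE -expr2 sqr_ge0.
Qed.
End FunctionalCalculus.

Lemma mxtrace_quad (R : realType) m (C X : 'M[R]_m) : psdmx C ->
  0 <= \tr (X^T *m C *m X).
Proof.
case=> _ C0; apply: sumr_ge0 => i _.
suff -> : (X^T *m C *m X) i i = ((col i X)^T *m C *m col i X) 0 0 by [].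
rewrite tr_col -row_mul [LHS]mxE [RHS]mxE; apply: eq_bigr => k _.
by rewrite [row _ _ _ _]mxE [col _ _ _ _]mxE.
Qed.

Lemma trmulmx_eq0 (R : realType) p q (X : 'M[R]_(p, q)) :
  \tr (X^T *m X) <= 0 -> X = 0.
Proof.
have sq0 (i : 'I_q) (k : 'I_p) : true -> 0 <= X^T i k * X k i.
  by rewrite mxE -expr2 sqr_ge0.
have row0 (i : 'I_q) : true -> 0 <= (X^T *m X) i i.
  by rewrite mxE => _; apply: sumr_ge0 => k _; apply: sq0.
move=> le0; have tr0 : \tr (X^T *m X) == 0.
  by rewrite eq_le le0; apply: sumr_ge0.
move: tr0; rewrite psumr_eq0 // => /allP diag0.
apply/matrixP => k i; rewrite mxE.
have := diag0 i (mem_index_enum _); rewrite /= mxE psumr_eq0; last exact: sq0.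
by move=> /allP/(_ k (mem_index_enum _)) /=; rewrite mxE mulf_eq0 orbb => /eqP.
Qed.

(** With X = C - T one has XC + TX = 0, hence tr(XCX) + tr(XTX) = 0 where both
    terms are nonnegative. So tr((SX)^T SX) = tr(XTX) vanishes, which gives
    TX = 0 and XC = 0, and finally X^2 = X (C - T) = 0. *)
Lemma psd_sqrt_unique (R : realType) m (C T S : 'M[R]_m) :
  psdmx C -> T^T = T -> S^T = S -> T = S *m S -> C *m C = T *m T -> C = T.
Proof.
move=> Cpsd Tsym Ssym TS CT; have [Csym _] := Cpsd.
pose X := C - T.
have Xsym : X^T = X by rewrite linearB /= Csym Tsym.
have XCTX : X *m C + T *m X = 0.
  by rewrite mulmxBl mulmxBr addrA subrK CT subrr.
have SX0 : S *m X = 0.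
  apply: trmulmx_eq0; rewrite trmx_mul Ssym.
  have -> : \tr (X^T *m S *m (S *m X)) = - \tr (X^T *m C *m X).
    rewrite -!mulmxA (mulmxA S) -TS; apply/eqP.
    rewrite -addr_eq0 [X in _ + X]mxtrace_mulC Xsym.
    rewrite -mulmxA [X in _ + X]mxtrace_mulC.
    by rewrite -mulmxA -raddfD /= -mulmxDr addrC XCTX mulmx0 mxtrace0.
  by rewrite oppr_le0 mxtrace_quad.
have TX0 : T *m X = 0 by rewrite TS -mulmxA SX0 mulmx0.
have XT0 : X *m T = 0 by rewrite -Xsym -Tsym -trmx_mul TX0 trmx0.
have XC0 : X *m C = 0 by move: XCTX; rewrite TX0 addr0.
apply/subr0_eq/trmulmx_eq0; rewrite -/X Xsym {2}/X mulmxBr XC0 XT0 subr0.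
by rewrite mxtrace0.
Qed.

Section SpectralParts.
Variables (R : realType) (m : nat) (Q : 'M[R]_m) (s : 'rV[R]_m).
Hypothesis Qu : Q \in unitmx.
Local Notation F := (spectral_fun Q s).
Local Notation A := (F id).
Hypothesis Asym : A^T = A.

Let Fsym g : (F g)^T = F g := trmx_spectral_fun Qu Asym g.

Lemma sqrtmx_spectral g : (forall a, 0 <= g a) ->
  sqrtmx (F g) = F (fun a => Num.sqrt (g a)).
Proof.
move=> g0; set T := RHS.
have TT : T *m T = F g.
  rewrite spectral_funM //; apply: eq_spectral_fun => a.
  by rewrite /= -expr2 sqr_sqrtr.
have Tpsd : psdmx T by apply: spectral_fun_psd => // a; apply: sqrtr_ge0.
rewrite /sqrtmx; case: xgetP => [C _ [Cpsd CC]|/(_ T)[]]; last by split.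
apply: (@psd_sqrt_unique _ _ _ _ (F (fun a => Num.sqrt (Num.sqrt (g a)))));
  rewrite ?Fsym //; last by rewrite CC.
rewrite spectral_funM //; apply: eq_spectral_fun => a.
by rewrite /= -expr2 sqr_sqrtr // sqrtr_ge0.
Qed.

Lemma absmx_spectral : absmx A = F Num.norm.
Proof.
have -> : absmx A = sqrtmx (F (fun a => a ^+ 2)).
  by rewrite /absmx spectral_funM.
rewrite sqrtmx_spectral => [|a]; last exact: sqr_ge0.
by apply: eq_spectral_fun => a; rewrite sqrtr_sqr.
Qed.

Lemma pospart_spectral : pospart A = F (Num.max 0).
Proof.
rewrite /pospart absmx_spectral spectral_fun_lin; apply: eq_spectral_fun => a.
have [a0|a0] := leP 0 a.
  by rewrite ger0_norm // -mulr2n -[a *+ 2]mulr_natl mulKf ?pnatr_eq0.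
by rewrite ltr0_norm // addNr mulr0.
Qed.

Lemma negpart_spectral : negpart A = F (fun a => Num.max 0 (- a)).
Proof.
rewrite /negpart absmx_spectral spectral_funN spectral_fun_lin.
apply: eq_spectral_fun => a.
have [a0|a0] := leP a 0.
  rewrite ler0_norm // -mulr2n -[- a *+ 2]mulr_natl mulKf ?pnatr_eq0 //.
  by rewrite max_r // oppr_ge0.
by rewrite gtr0_norm // subrr mulr0 max_l // oppr_le0 ltW.
Qed.

End SpectralParts.

(** * The square roots of the positive and negative parts *)

(** g(A) x is a combination of the columns of Q^-1, eigenvectors of A, in which
    only those with g(a) != 0 for their eigenvalue a occur. *)
Lemma spectral_fun_eigspan (R : realType) n (Q : 'M[R]_(n + n)) s
    (P : R -> Prop) (g : R -> R) (x : 'cV[R]_(n + n)) :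
  Q \in unitmx -> (forall a, g a != 0 -> P a) ->
  GRing.submod_closed [in eigspan (spectral_fun Q s id) P] ->
  eigspan (spectral_fun Q s id) P (spectral_fun Q s g *m x).
Proof.
move=> Qu gP; set W := eigspan _ P => -[W0 Wlin].
have Aq i : spectral_fun Q s id *m col i (invmx Q) = s 0 i *: col i (invmx Q).
  rewrite !colE mulmxA -!colE /spectral_fun map_mx_id // mulmxK //.
  by apply/colP => k; rewrite mxE mul_mx_diag !mxE mulrC.
have -> : spectral_fun Q s g *m x =
    \sum_i (g (s 0 i) * (Q *m x) i 0) *: col i (invmx Q).
  rewrite /spectral_fun -mulmxA; apply/colP => k.
  rewrite mxE summxE; apply: eq_bigr => i _.
  rewrite mul_mx_diag [in LHS]mxE [RHS]mxE [col _ _ _ _]mxE [map_mx _ _ _ _]mxE.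
  by rewrite -mulrA mulrC.
suff inW (v : 'cV[R]_(n + n)) : v \in [in W] -> W v.
  apply: inW; elim/big_ind: _ => [||i _]; first exact: W0.
    by move=> u v uW vW; have := Wlin 1 u v uW vW; rewrite scale1r.
  have [g0|g0] := eqVneq (g (s 0 i)) 0; first by rewrite g0 mul0r scale0r.
  rewrite -[_ *: _]addr0; apply: Wlin => //.
  rewrite unfold_in; apply/mem_set.
  exists 1%N, (fun=> 1), (fun=> col i (invmx Q)); split=> [_|].
    split; last by exists (s 0 i); split=> //; apply: gP.
    apply/eqP => /(congr1 (mulmx Q)); rewrite colE mulKVmx // mulmx0.
    by move/colP/(_ i)/eqP; rewrite !mxE !eqxx oner_eq0.
  by rewrite big_ord1 scale1r.
by rewrite unfold_in => /set_mem.
Qed.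

(** The entries of B J C are the symplectic products of the columns of B, which
    lie in the positive eigenspace, with those of C, in the negative one. *)
Lemma sqrt_parts (R : realType) n (A : 'M[R]_(n + n))
    (B := sqrtmx (pospart A)) (C := sqrtmx (negpart A)) : EigSpSm A ->
  [/\ B^T = B, C^T = C, A = B *m B - C *m C & B *m sympJ *m C = 0].
Proof.
move=> [Asym [[negW _] _ [posW _]] [_ npO _] _].
have [Q [s [Qu AE]]] := symmetric_diagonalizable Asym.
have AF : A = spectral_fun Q s id by rewrite AE /spectral_fun map_mx_id.
have symF : (spectral_fun Q s id)^T = spectral_fun Q s id by rewrite -AF.
pose p a : R := Num.sqrt (Num.max 0 a); pose q a : R := p (- a).
have max0 a : 0 <= Num.max 0 a :> R by rewrite le_max lexx.
have BF : B = spectral_fun Q s p.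
  by rewrite /B AF pospart_spectral // sqrtmx_spectral.
have CF : C = spectral_fun Q s q.
  by rewrite /C AF negpart_spectral // sqrtmx_spectral.
have pN0 a : p a != 0 -> 0 < a.
  by apply: contraNT; rewrite -leNgt /p => a0; rewrite max_l // sqrtr0.
have Bsym : B^T = B by rewrite BF trmx_spectral_fun.
have Csym : C^T = C by rewrite CF trmx_spectral_fun.
split=> //.
  rewrite BF CF !spectral_funM // spectral_funN -[RHS]scale1r.
  rewrite spectral_fun_lin AF.
  apply: eq_spectral_fun => a; rewrite mul1r -!expr2 !sqr_sqrtr //.
  have [a0|a0] := leP 0 a; last by rewrite max_r ?sub0r ?opprK // oppr_ge0 ltW.
  by rewrite max_l ?subr0 // oppr_le0.
have Bpos x : Epos A (B *m x).
  by rewrite BF; move: posW; rewrite /Epos AF; apply: spectral_fun_eigspan.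
have Cneg x : Eneg A (C *m x).
  rewrite CF; move: negW; rewrite /Eneg AF; apply: spectral_fun_eigspan => // a.
  by move/pN0; rewrite oppr_gt0.
apply/matrixP => i j.
have := npO _ (Bpos (delta_mx i 0)) _ (Cneg (delta_mx j 0)).
rewrite /dotv trmx_mul Bsym trmx_delta !mulmxA -!rowE.
rewrite -!row_mul mxE -colE mxE => ->.
by rewrite mxE.
Qed.

(** * Comparison of dimensions through the Hermitian form of A *)

(** Dimension count: the coordinates in J of the values of f form a linear map
    that is injective on the space of vectors supported on I. *)
Lemma leq_card_supported (K : fieldType) p m (f : 'M[K]_(p, m))
    (I : {pred 'I_m}) (J : {pred 'I_p}) :
  (forall x : 'cV_m, (forall i, i \notin I -> x i 0 = 0) ->
     (forall j, j \in J -> (f *m x) j 0 = 0) -> x = 0) ->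
  (#|I| <= #|J|)%N.
Proof.
move=> inj.
pose T : 'M[K]_(#|I|, #|J|) := \matrix_(k, l) f (enum_val l) (enum_val k).
suff /eqP <- : row_free T by apply: rank_leq_col.
apply: inj_row_free => v vT0; apply/rowP => k.
pose x : 'cV[K]_m := \sum_k v 0 k *: delta_mx (enum_val k) 0.
have -> : v 0 k = x (enum_val k) 0.
  rewrite /x summxE (bigD1 k) //= !mxE !eqxx mulr1 big1 ?addr0 // => l lk.
  by rewrite !mxE (inj_eq enum_val_inj) eq_sym (negPf lk) mulr0.
suff -> : x = 0 by rewrite !mxE.
apply: inj => [i iI|j jJ].
  rewrite /x summxE big1 // => l _; rewrite !mxE andbT; case: eqP => [iE|_].
    by move: iI; rewrite iE enum_valP.
  by rewrite mulr0.
transitivity ((v *m T) 0 (enum_rank_in jJ j)); last by rewrite vT0 mxE.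
rewrite /x mulmx_sumr summxE [RHS]mxE; apply: eq_bigr => l _.
by rewrite -scalemxAr -colE !mxE enum_rankK_in.
Qed.

Section HermitianForm.
Variable K : numClosedFieldType.

Definition sqnorm m (x : 'cV[K]_m) : K := \sum_i `|x i 0| ^+ 2.

Lemma sqnorm_ge0 m (x : 'cV[K]_m) : 0 <= sqnorm x.
Proof. by apply: sumr_ge0 => i _; rewrite exprn_ge0. Qed.

Lemma sqnorm_eq0 m (x : 'cV[K]_m) : sqnorm x <= 0 -> x = 0.
Proof.
move=> le0; have : sqnorm x == 0 by rewrite eq_le le0 sqnorm_ge0.
rewrite psumr_eq0 => [/allP x0|i _]; last by rewrite exprn_ge0.
apply/colP => i; rewrite mxE; move/(_ i (mem_index_enum _)): x0.
by rewrite /= expf_eq0 normr_eq0 => /eqP.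
Qed.

Definition qform m (S : 'M[K]_m) (w : 'cV[K]_m) : K := (w^t* *m S *m w) 0 0.

Lemma adjointM p q r (X : 'M[K]_(p, q)) (Y : 'M[K]_(q, r)) :
  (X *m Y)^t* = Y^t* *m X^t*.
Proof. by rewrite trmx_mul map_mxM. Qed.

Lemma qform_gram m p (S : 'M[K]_(p, m)) w :
  qform (S^t* *m S) w = sqnorm (S *m w).
Proof.
rewrite /qform mulmxA -adjointM -mulmxA; move: (S *m w) => v.
by rewrite mxE; apply: eq_bigr => i _; rewrite !mxE mulrC -normCK.
Qed.

Lemma qform_congr m (S N : 'M[K]_m) w :
  qform S (N *m w) = qform (N^t* *m S *m N) w.
Proof. by rewrite /qform adjointM !mulmxA. Qed.
End HermitianForm.

(** Here M satisfies M^* J M = J, as the complexification of a real symplectic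
    matrix does. *)
Section SymplecticEigenvalueCount.
Variables (K : numClosedFieldType) (n : nat).
Let J : 'M[K]_(n + n) := block_mx 0 1%:M (- 1%:M) 0.
Variables (A B C M : 'M[K]_(n + n)) (d : 'rV[K]_n) (l : K).
Hypotheses (Bherm : B^t* = B) (Cherm : C^t* = C).
Hypotheses (AE : A = B *m B - C *m C) (BJC : B *m J *m C = 0).
Hypotheses (MJM : M^t* *m J *m M = J).
Hypotheses (MAM : M^t* *m A *m M = block_mx (diag_mx d) 0 0 (diag_mx d)).
Hypotheses (dreal : forall j, d 0 j \is Num.real) (l_gt0 : 0 < l).

Let D2 : 'M[K]_(n + n) := block_mx (diag_mx d) 0 0 (diag_mx d).
Let H := 'i *: (B *m J *m B).

Lemma qform_D2 (a b : 'cV[K]_n) :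
  qform D2 (col_mx a b) = \sum_j d 0 j * (`|a j 0| ^+ 2 + `|b j 0| ^+ 2).
Proof.
rewrite /qform /D2 tr_col_mx map_row_mx mul_row_block !mulmx0 addr0 add0r.
rewrite mul_row_col mxE !mul_mx_diag.
rewrite [X in X + _]mxE [X in _ + X]mxE -big_split; apply: eq_bigr => j _ /=.
rewrite !mxE !normCK mulrDr.
ring.
Qed.

Let adjJ : J^t* = - J.
Proof.
rewrite /J tr_block_mx map_block_mx !trmx0 linearN /= trmx1 !map_mx0.
by rewrite opp_block_mx map_mxN map_mx1 !oppr0 opprK.
Qed.

Let JJ : J *m J = - 1%:M.
Proof.
rewrite /J mulmx_block !mul0mx !mulmx0 !add0r !addr0 mulNmx mulmxN !mulmx1.
by rewrite (scalar_mx_block _ _ (1 : K)) opp_block_mx !oppr0.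
Qed.

(* The inverse of M, as M is symplectic. *)
Let N : 'M[K]_(n + n) := - (J *m M^t* *m J).

Let NM : N *m M = 1%:M.
Proof. by rewrite /N mulNmx -!mulmxA (mulmxA _ J) MJM JJ opprK. Qed.

Let MN : M *m N = 1%:M.
Proof. exact: mulmx1C NM. Qed.

Let MJMt : M *m J *m M^t* = J.
Proof.
have : M *m N *m J = J by rewrite MN mul1mx.
by rewrite /N mulmxN mulNmx -!mulmxA JJ !mulmxN mulmx1 opprK !mulmxA.
Qed.

Let JAM : J *m A *m M = M *m (J *m D2).
Proof. by rewrite -[D2]MAM !mulmxA MJMt. Qed.

Let CJB : C *m J *m B = 0.
Proof.
have := congr1 (fun X => X^t*) BJC.
rewrite !adjointM Bherm Cherm adjJ trmx0 map_mx0 mulmxA mulmxN mulNmx => /eqP.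
by rewrite oppr_eq0 => /eqP.
Qed.

Lemma qformA w : qform A w = sqnorm (B *m w) - sqnorm (C *m w).
Proof.
rewrite -!qform_gram Bherm Cherm AE /qform mulmxBr mulmxBl.
by rewrite [LHS]mxE [X in _ + X]mxE.
Qed.

Lemma eigen_JD2 (a b : 'cV[K]_n) :
  'i *: (J *m D2 *m col_mx a b) = l *: col_mx a b <->
  forall j, 'i * (d 0 j * b j 0) = l * a j 0 /\
            'i * (d 0 j * a j 0) = - (l * b j 0).
Proof.
have -> : J *m D2 *m col_mx a b = col_mx (diag_mx d *m b) (- (diag_mx d *m a)).
  rewrite /J /D2 mulmx_block !mul0mx !mulmx0 !mul1mx !add0r !addr0.
  by rewrite mulNmx mul1mx mul_block_col !mul0mx mulNmx addr0 add0r.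
rewrite !scale_col_mx scalerN; split=> [/eq_col_mx[/colP ab /colP ba] j|ab].
  have := ab j; have := ba j; rewrite !mul_diag_mx !mxE => <- ->.
  by rewrite opprK.
congr col_mx; apply/colP => j; have [abj baj] := ab j;
  by rewrite !mul_diag_mx !mxE ?abj // baj opprK.
Qed.

(** The vector y = M^-1 JBv satisfies iJ(D (+) D) y = l y, and
    y^* (D (+) D) y = |BJBv|^2. If the lower half b of y vanishes at all j with
    d_j = l, then b and with it the upper half are supported on the indices with
    d_j = -l, so this value is nonpositive and v = 0. *)
Lemma eigvec_lower (v : 'cV[K]_(n + n)) : H *m v = l *: v ->
  (forall j, d 0 j = l -> dsubmx (N *m J *m B *m v) j 0 = 0) -> v = 0.
Proof.
move=> Hv b0; pose w := J *m B *m v; pose y := N *m w.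
have yE : N *m J *m B *m v = y by rewrite /y /w !mulmxA.
have Hv' : 'i *: (B *m w) = l *: v.
  by rewrite -Hv /H /w -scalemxAl !mulmxA.
have Cw : C *m w = 0 by rewrite /w !mulmxA CJB mul0mx.
have My : M *m y = w by rewrite /y mulmxA MN mul1mx.
have JAw : 'i *: (J *m A *m w) = l *: w.
  rewrite -mulmxA AE mulmxBl -[C *m C *m w]mulmxA Cw mulmx0 subr0 -mulmxA.
  by rewrite scalemxAr scalemxAr Hv' -!scalemxAr /w mulmxA.
have JDy : 'i *: (J *m D2 *m y) = l *: y.
  have -> : l *: y = N *m ('i *: (J *m A *m w)) by rewrite JAw -scalemxAr.
  rewrite -scalemxAr -{1}My [J *m A *m _]mulmxA JAM.
  by rewrite -[M *m _ *m y]mulmxA (mulmxA N) NM mul1mx.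
have qy : qform D2 y <= 0.
  move: JDy b0; rewrite yE -(vsubmxK y) col_mxKd.
  move: (usubmx y) (dsubmx y) => a b /eigen_JD2 ab b0; rewrite qform_D2.
  apply: sumr_le0 => j _; have [abj baj] := ab j.
  have [d_le0|d_gt0] := real_leP (dreal j) (real0 K).
    by rewrite mulr_le0_ge0 // addr_ge0 // exprn_ge0.
  have bj0 : b j 0 = 0.
    have [/b0 //|dl] := eqVneq (d 0 j) l.
    (* Eliminating a_j from the two eigenvector equations. *)
    have dbl : (d 0 j ^+ 2 - l ^+ 2) * b j 0 = 0.
      apply: (mulfI (neq0Ci K)); rewrite mulr0 mulrBl mulrBr.
      rewrite expr2 -mulrA mulrCA abj mulrCA.
      have -> : d 0 j * a j 0 = 'i * (l * b j 0).
        apply: (mulfI (neq0Ci K)).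
        by rewrite baj [RHS]mulrA -expr2 sqrCi mulN1r.
      by ring.
    apply/eqP; move/eqP: dbl; rewrite subr_sqr !mulf_eq0 subr_eq0 (negPf dl) /=.
    by rewrite gt_eqF ?addr_gt0.
  have aj0 : a j 0 = 0.
    move/eqP: abj; rewrite bj0 !mulr0 eq_sym mulf_eq0 gt_eqF //= => /eqP //.
  by rewrite aj0 bj0 !normr0 expr0n addr0 mulr0.
have Bw0 : B *m w = 0.
  apply: sqnorm_eq0; move: qy; rewrite /D2 -MAM -qform_congr My qformA Cw.
  rewrite [X in _ - X](_ : _ = 0) ?subr0 // /sqnorm big1 // => i _.
  by rewrite mxE normr0 expr0n.
apply/eqP; move/eqP: Hv'; rewrite Bw0 scaler0 eq_sym scaler_eq0.
by rewrite gt_eqF.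
Qed.

(** For w = M (iy, y) with y supported on the j with d_j = l, the form is
    w^* A w = 2l|y|^2, whereas w^* A w = |Bw|^2 - |Cw|^2. *)
Lemma eigvec_upper (y : 'cV[K]_n) : (forall j, d 0 j != l -> y j 0 = 0) ->
  let v := B *m M *m col_mx ('i *: y) y in
  H *m v = l *: v /\ (v = 0 -> y = 0).
Proof.
move=> ysupp; pose z := col_mx ('i *: y) y; pose w := M *m z => v.
have dy j : d 0 j * y j 0 = l * y j 0.
  by have [->//|/ysupp->] := eqVneq (d 0 j) l; rewrite !mulr0.
have vE : v = B *m w by rewrite /v /w mulmxA.
have JAw : 'i *: (J *m A *m w) = l *: w.
  rewrite /w mulmxA JAM -[M *m _ *m _]mulmxA [LHS]scalemxAr [RHS]scalemxAr.
  congr (_ *m _); apply/eigen_JD2 => j; rewrite !mxE dy mulrCA; split=> //.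
  by rewrite (mulrCA _ 'i) dy mulrA -expr2 sqrCi mulN1r.
have AC : B *m J *m A = B *m J *m B *m B.
  by rewrite AE mulmxBr [X in _ - X]mulmxA BJC mul0mx subr0 mulmxA.
split=> [|v0].
  rewrite vE /H -scalemxAl mulmxA -AC -[B *m J *m A]mulmxA -[B *m _ *m w]mulmxA.
  by rewrite scalemxAr JAw -scalemxAr.
have : qform D2 z <= 0.
  rewrite /D2 -MAM -qform_congr -/w qformA -vE v0.
  rewrite [X in X - _](_ : _ = 0) ?sub0r ?oppr_le0 ?sqnorm_ge0 //.
  by rewrite /sqnorm big1 // => i _; rewrite mxE normr0 expr0n.
rewrite qform_D2.
have -> : \sum_j d 0 j * (`|('i *: y) j 0| ^+ 2 + `|y j 0| ^+ 2) =
    l * (sqnorm y *+ 2).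
  rewrite /sqnorm -sumrMnl mulr_sumr; apply: eq_bigr => j _.
  rewrite mxE normrM normCi mul1r -mulr2n.
  have [->//|/ysupp->] := eqVneq (d 0 j) l.
  by rewrite normr0 expr0n mul0rn !mulr0.
by rewrite pmulr_rle0 // pmulrn_lle0 // => /sqnorm_eq0.
Qed.

(** The coordinates with respect to the orthonormal eigenbasis of H serve on one
    side, the lower half of the coordinates with respect to M on the other. *)
Theorem card_spectral_diag_eq :
  #|[pred i | spectral_diag H 0 i == l]| = #|[pred j | d 0 j == l]|.
Proof.
have Hherm : H \is hermsymmx.
  apply/is_hermitianmxP; rewrite expr0 scale1r /H linearZ /= map_mxZ /= conjCi.
  rewrite !adjointM Bherm adjJ mulNmx mulmxN scalerN scaleNr opprK.
  by rewrite mulmxA.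
have Hsp := orthomx_spectralP (hermitian_normalmx Hherm).
have PU := spectral_unit H.
move: (spectral_diag H) (spectralmx H) PU Hsp => h P PU Hsp.
have PH : P *m H = diag_mx h *m P by rewrite Hsp !mulmxA mulmxV // mul1mx.
have HP : H *m invmx P = invmx P *m diag_mx h by rewrite Hsp mulmxK.
apply/eqP; rewrite eqn_leq; apply/andP; split.
  apply: (@leq_card_supported _ _ _ (dsubmx (N *m J *m B *m invmx P))).
  move=> x xsupp x0; have hx : diag_mx h *m x = l *: x.
    apply/colP => i; rewrite mul_diag_mx !mxE.
    by have [->//|/xsupp->] := eqVneq (h 0 i) l; rewrite !mulr0.
  suff Px0 : invmx P *m x = 0 by rewrite -[x](mulKVmx PU) Px0 mulmx0.
  apply: eigvec_lower => [|j dj].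
    by rewrite mulmxA HP -mulmxA hx -scalemxAr.
  by rewrite mulmxA -mul_dsub_mx x0 // inE dj.
pose G : 'M[K]_(n + n, n) := P *m (B *m M *m col_mx ('i%:M) 1%:M).
apply: (@leq_card_supported _ _ _ G) => y ysupp Gy.
have GE : G *m y = P *m (B *m M *m col_mx ('i *: y) y).
  by rewrite /G -!mulmxA mul_col_mx !mul_scalar_mx scale1r.
have [] := eigvec_upper ysupp; set v := B *m M *m _ => Hv; apply.
rewrite -[v](mulKmx PU) -GE; suff -> : G *m y = 0 by rewrite mulmx0.
apply/colP => i; rewrite [RHS]mxE.
have [hi|hi] := eqVneq (h 0 i) l; first by apply: Gy; rewrite inE hi.
have : (diag_mx h *m (G *m y)) i 0 = l * (G *m y) i 0.
  rewrite GE [diag_mx h *m _]mulmxA -PH -[P *m H *m _]mulmxA Hv.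
  by rewrite -scalemxAr [LHS]mxE.
rewrite mul_diag_mx mxE => /eqP; rewrite -subr_eq0 -mulrBl mulf_eq0 subr_eq0.
by rewrite (negPf hi) => /eqP.
Qed.
End SymplecticEigenvalueCount.

(** * Multiplicities of eigenvalues *)

Local Open Scope complex_scope.

Lemma count_enum_map (I : finType) (T : eqType) (f : I -> T) z :
  count_mem z [seq f i | i <- enum I] = #|[pred i | f i == z]|.
Proof. by rewrite count_map -sum1_count big_enum_cond sum1_card. Qed.

Lemma mup_char_poly_diagonalized (K : fieldType) m (Q : 'M[K]_m) s z :
  Q \in unitmx ->
  mup z (char_poly (invmx Q *m diag_mx s *m Q)) = #|[pred i | s 0 i == z]|.
Proof.
move=> Qu; rewrite char_poly_diagonalized // -count_enum_map.
by rewrite -mu_prod_XsubC big_map big_enum.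
Qed.

Lemma count_eigenvalues (K : closedFieldType) m (H : 'M[K]_m) z :
  count_mem z (eigenvalues H) = mup z (char_poly H).
Proof.
rewrite /eigenvalues; case: closed_field_poly_normal => r /= ->.
by rewrite (monicP (char_poly_monic H)) scale1r mu_prod_XsubC.
Qed.

(** H and - H = H^T have the same characteristic polynomial. *)
Lemma mup_char_poly_skew (K : numClosedFieldType) m (H : 'M[K]_m) z :
  H^t* = H -> H^T = - H -> mup z (char_poly H) = mup (- z) (char_poly H).
Proof.
move=> Hherm Hskew.
have Hh : H \is hermsymmx by apply/is_hermitianmxP; rewrite expr0 scale1r Hherm.
have HE := orthomx_spectralP (hermitian_normalmx Hh).
move: (spectral_diag H) (spectralmx H) (spectral_unit H) HE => h P Pu HE.
have cN : char_poly H = char_poly (- H).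
  rewrite -Hskew /char_poly -[RHS]det_tr; congr (\det _).
  by rewrite /char_poly_mx linearB /= tr_scalar_mx map_trmx trmxK.
have NHE : - H = invmx P *m diag_mx (- h) *m P.
  by rewrite HE -mulNmx -mulmxN; congr (_ *m _ *m _); rewrite raddfN.
rewrite {1}cN NHE HE !mup_char_poly_diagonalized //.
by apply: eq_card => i; rewrite !inE mxE eqr_oppLR.
Qed.

(** Multiplication by Y embeds the kernel of diag(s) into that of diag(t). *)
Lemma card_zero_diag_le (K : fieldType) m (s t : 'rV[K]_m) (X Y : 'M[K]_m) :
  X \in unitmx -> Y \in unitmx -> diag_mx s = X *m diag_mx t *m Y ->
  (#|[pred i | s 0 i == 0]%R| <= #|[pred i | t 0 i == 0]%R|)%N.
Proof.
move=> Xu Yu sE; apply: (leq_card_supported (f := Y)) => x xsupp Yx.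
suff Yx0 : Y *m x = 0 by rewrite -(mulKmx Yu x) Yx0 mulmx0.
have : diag_mx t *m (Y *m x) = 0.
  rewrite -(mulKmx Xu (diag_mx t *m _)) [X *m (_ *m _)]mulmxA.
  rewrite [X *m _ *m (_ *m _)]mulmxA -sE.
  suff -> : diag_mx s *m x = 0 by rewrite mulmx0.
  apply/colP => i; rewrite mul_diag_mx !mxE.
  by have [->|/xsupp->] := eqVneq (s 0 i) 0; rewrite ?mul0r ?mulr0.
move=> tYx; apply/colP => i; rewrite [RHS]mxE.
have [ti|ti] := eqVneq (t 0 i) 0; first by apply: Yx; rewrite inE ti.
move/colP/(_ i)/eqP: tYx; rewrite mul_diag_mx mxE [X in _ == X]mxE mulf_eq0.
by rewrite (negPf ti) => /eqP.
Qed.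

Lemma symplectic_unit (R : realType) n (M : 'M[R]_(n + n)) :
  symplectic M -> M \in unitmx.
Proof.
move=> MJM; have Ju : (sympJ : 'M[R]_(n + n)) \in unitmx.
  suff /mulmx1_unit [] : (sympJ : 'M[R]_(n + n)) *m (- sympJ) = 1%:M by [].
  rewrite /sympJ opp_block_mx mulmx_block !oppr0 opprK !mul0mx !mulmx0.
  rewrite !add0r !addr0 mulmxN mulNmx opprK !mulmx1.
  by rewrite (scalar_mx_block _ _ (1 : R)).
suff /mulmx1_unit [] : (invmx sympJ *m M^T *m sympJ) *m M = 1%:M by [].
by rewrite -!mulmxA (mulmxA M^T) MJM mulVmx.
Qed.

Lemma xi_sympl_eigenvalues (R : realType) n (A : 'M[R]_(n + n)) (d : 'rV[R]_n) :
  A^T = A -> is_sympl_eigenvalues A d -> xi A = #|[pred j | d 0 j == 0]|.*2.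
Proof.
move=> Asym [M [/symplectic_unit Mu MAM]].
have [Q [s [Qu AE]]] := symmetric_diagonalizable Asym.
have MTu : M^T \in unitmx by rewrite unitmx_tr.
rewrite /xi AE mup_char_poly_diagonalized //; pose t := row_mx d d.
have tE : diag_mx t = M^T *m invmx Q *m diag_mx s *m (Q *m M).
  by rewrite diag_mx_row -MAM AE !mulmxA.
have sE : diag_mx s = (Q *m invmx M^T) *m diag_mx t *m (invmx M *m invmx Q).
  by rewrite tE !mulmxA mulmxKV // mulmxV // mul1mx mulmxK // mulmxK.
transitivity #|[pred i | t 0 i == 0]|.
  apply/eqP; rewrite eqn_leq; apply/andP; split.
    apply: card_zero_diag_le sE;
      by rewrite unitmx_mul !unitmx_inv ?Qu ?Mu ?MTu.
  apply: card_zero_diag_le tE; by rewrite unitmx_mul ?unitmx_inv ?Qu ?Mu ?MTu.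
rewrite -!sum1_card big_split_ord -addnn /=; congr (_ + _)%N;
  by apply: eq_bigl => j; rewrite !inE /t ?row_mxEl ?row_mxEr.
Qed.

Lemma iBJB_skew_hermitian (R : realType) n (B : 'M[R]_(n + n)) : B^T = B ->
  let H := 'i%C *: map_mx (real_complex R) (B *m sympJ *m B) in
  H^T = - H /\ H^t* = H.
Proof.
move=> Bsym H; have skew : H^T = - H.
  rewrite /H linearZ /= -scalerN; congr (_ *: _); rewrite map_trmx -map_mxN.
  rewrite !trmx_mul Bsym mulmxA -mulNmx -mulmxN; congr (map_mx _ (_ *m _ *m _)).
  by rewrite tr_block_mx opp_block_mx !trmx0 linearN /= trmx1 !oppr0 opprK.
split=> //; rewrite skew /H complexiE map_mxN map_mxZ /= conjCi scaleNr opprK.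
congr (_ *: _); apply/matrixP => i j; rewrite [LHS]mxE.
by apply/CrealP/complex_realP; rewrite mxE; eexists.
Qed.

Lemma count_eigenvalues_iBJB (R : realType) n (A B C : 'M[R]_(n + n)) d
    (z : R[i]) :
  is_sympl_eigenvalues A d ->
  B^T = B -> C^T = C -> A = B *m B - C *m C -> B *m sympJ *m C = 0 -> 0 < z ->
  count_mem z (eigenvalues ('i%C *: map_mx (real_complex R) (B *m sympJ *m B)))
    = #|[pred j | (d 0 j)%:C == z]|.
Proof.
move=> [M [MJM MAM]] Bsym Csym AE BJC z0; pose rc := real_complex R.
have adj p q (X : 'M[R]_(p, q)) : (map_mx rc X)^t* = map_mx rc X^T.
  by apply/matrixP => i j; rewrite !mxE; apply/CrealP/complex_realP; eexists.
pose J : 'M[R[i]]_(n + n) := block_mx 0 1%:M (- 1%:M) 0.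
have rcJ : map_mx rc sympJ = J by rewrite map_block_mx !map_mx0 map_mxN map_mx1.
have D2E : block_mx (diag_mx (map_mx rc d)) 0 0 (diag_mx (map_mx rc d)) =
    map_mx rc (block_mx (diag_mx d) 0 0 (diag_mx d)).
  by rewrite map_block_mx !map_diag_mx !map_mx0.
have := @card_spectral_diag_eq R[i] n (map_mx rc A) (map_mx rc B) (map_mx rc C)
  (map_mx rc M) (map_mx rc d) z.
rewrite -/J -rcJ D2E !adj Bsym Csym -!map_mxM -map_mxB MJM MAM -AE BJC map_mx0.
rewrite -complexiE -/rc.
have dreal j : (map_mx rc d) 0 j \is Num.real.
  by rewrite mxE; apply/complex_realP; eexists.
move=> /(_ erefl erefl erefl erefl erefl erefl dreal z0) cardE.
have [_ Hherm] := iBJB_skew_hermitian Bsym.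
rewrite count_eigenvalues; set H := _ *: _ in Hherm cardE *.
have Hh : H \is hermsymmx by apply/is_hermitianmxP; rewrite expr0 scale1r Hherm.
rewrite [X in char_poly X](orthomx_spectralP (hermitian_normalmx Hh)).
rewrite mup_char_poly_diagonalized ?spectral_unit // cardE.
by apply: eq_card => j; rewrite !inE mxE.
Qed.

Lemma is_sympl_eigenvaluesN (R : realType) n (A : 'M[R]_(n + n)) d :
  is_sympl_eigenvalues A d -> is_sympl_eigenvalues (- A) (- d).
Proof.
move=> [M [MJM MAM]]; exists M; split=> //.
by rewrite mulmxN mulNmx MAM opp_block_mx oppr0 raddfN.
Qed.

Lemma count_filter_mem (T : eqType) (p : pred T) z s :
  count_mem z (filter p s) = (p z * count_mem z s)%N.
Proof.
rewrite count_filter; case: (boolP (p z)) => pz; [rewrite mul1n|rewrite mul0n].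
  by apply: eq_count => x /=; case: eqP => // ->; rewrite pz.
rewrite -(count_pred0 s); apply: eq_count => x /=.
by case: eqP => // ->; rewrite (negPf pz).
Qed.

(* In R[i], z < 0 (resp. 0 < z) means that z is real and negative
   (resp. positive). *)
Theorem theorem5p3 (R : realType) (n : nat) (A : 'M[R]_(n + n)) (d : 'rV[R]_n)
    (hA : EigSpSm A) (hd : is_sympl_eigenvalues A d) :
  ~~ odd (xi A) /\
  perm_eq [seq (d 0 j)%:C | j <- enum 'I_n]
    (nseq (xi A)./2 0
      ++ [seq z <- eigenvalues (iBJB (negpart A)) | z < 0]
      ++ [seq z <- eigenvalues (iBJB (pospart A)) | 0 < z]).
Proof.
have [Asym _ _ _] := hA.
have [Bsym Csym AE BJC] := sqrt_parts hA.
rewrite (xi_sympl_eigenvalues Asym hd) odd_double doubleK; split=> //.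
apply/allP => z _; apply/eqP.
have cntP := count_eigenvalues_iBJB hd Bsym Csym AE BJC.
have NAE : - A = sqrtmx (negpart A) *m sqrtmx (negpart A) -
    sqrtmx (pospart A) *m sqrtmx (pospart A) by rewrite {1}AE opprB.
have CJB : sqrtmx (negpart A) *m sympJ *m sqrtmx (pospart A) = 0.
  have := congr1 trmx BJC; rewrite !trmx_mul Bsym Csym trmx0.
  rewrite {1}/sympJ tr_block_mx !trmx0 linearN /= trmx1 => CJB.
  apply/eqP; rewrite -oppr_eq0 -mulNmx -mulmxN /sympJ opp_block_mx !oppr0 opprK.
  by rewrite -mulmxA CJB.
have hdN := is_sympl_eigenvaluesN hd.
have cntN := count_eigenvalues_iBJB hdN Csym Bsym NAE CJB.
have [skew herm] := iBJB_skew_hermitian Csym.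
have cN : z < 0 -> count_mem z (eigenvalues (iBJB (negpart A))) =
    #|[pred j | (d 0 j)%:C == z]|.
  move=> z_lt0; rewrite count_eigenvalues mup_char_poly_skew //.
  rewrite -count_eigenvalues cntN ?oppr_gt0 //; apply: eq_card => j.
  by rewrite !inE mxE rmorphN eqr_opp.
have cP : 0 < z -> count_mem z (eigenvalues (iBJB (pospart A))) =
    #|[pred j | (d 0 j)%:C == z]| by apply: cntP.
move: (eigenvalues _) (eigenvalues _) cP cN => eN eP cP cN.
rewrite count_enum_map !count_cat count_nseq !count_filter_mem /=.
have [<-|zN0] := eqVneq 0 z.
  rewrite !ltxx !mul0n !addn0 mul1n.
  by apply: eq_card => j; rewrite !inE fmorph_eq0.
rewrite mul0n add0n.
have [z_gt0|zNgt0] := boolP (0 < z).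
  by rewrite lt_gtF // mul0n mul1n add0n cP.
have [z_lt0|zNlt0] := boolP (z < 0).
  by rewrite mul0n addn0 mul1n cN.
rewrite !mul0n; apply: eq_card0 => j; rewrite !inE; apply/eqP => zE.
move: zN0 zNgt0 zNlt0; rewrite -zE eq_sym fmorph_eq0 !ltcR -!leNgt.
move=> dN0 d_le0 d_ge0.
by rewrite eq_le d_le0 d_ge0 in dN0.
Qed.
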